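(* The polynomial families $f_n(x)$ and $g_n(x)$ are related, for all $n\ge0$, by the equations $$g_n(x)=\sum_{k=0}^{\lfloor n/2\rfloor}\frac{2^{n-2k}(n-k)!}{(3/2)_{n-2k}\,k!}\,f_{n-2k}(x),$$ $$f_n(x)=\frac{(3/2)_n}{2^n(n+1)!}\sum_{k=0}^{\lfloor n/2\rfloor}(-1)^k(n-2k+1)\binom{n+1}{k}\,g_{n-2k}(x).$$
   Context: The polynomials $f_n$ (Meixner--Pollaczek polynomials $P_n^{(3/4)}(x;\pi/2)$) and $g_n$ (continuous Hahn polynomials $p_n(x;\frac34,\frac34,\frac34,\frac34)$) are $$f_n(x)=\frac{(3/2)_n}{n!}\,i^n\,{}_2F_1\left(-n,\tfrac34+ix;\tfrac32;2\right),\qquad g_n(x)=i^n(n+1)\,{}_3F_2\left(-n,n+2,\tfrac34+ix;\tfrac32,\tfrac32;1\right),$$ where $(a)_n=a(a+1)\cdots(a+n-1)$ is the Pochhammer symbol and ${}_2F_1,{}_3F_2$ are the (here terminating) hypergeometric series. *)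

(* Defs.v *)
From mathcomp Require Import all_boot all_order all_algebra.

Set Implicit Arguments.
Unset Strict Implicit.
Unset Printing Implicit Defensive.

Import Order.TTheory GRing.Theory Num.Theory.
Local Open Scope ring_scope.

Definition pochhammer (F : fieldType) (a : F) (n : nat) : F :=
  \prod_(j < n) (a + j%:R).

(* as_ and bs are the lists of numerator and denominator parameters of pFq. *)
Definition hypergeom_term (F : fieldType) (as_ bs : seq F) (z : F) (k : nat) : F :=
  (\prod_(a <- as_) pochhammer a k) / (\prod_(b <- bs) pochhammer b k)
    * (z ^+ k / k`!%:R).

(* The series up to and including the term of index n; it is the whole series
   when - n is a numerator parameter, by hypergeom_term_eq0. *)
Definition hypergeom_upto (F : fieldType) (n : nat) (as_ bs : seq F) (z : F) : F :=
  \sum_(0 <= k < n.+1) hypergeom_term as_ bs z k.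

Lemma hypergeom_term_eq0 (F : fieldType) (n k : nat) (as_ bs : seq F) (z : F) :
  - n%:R \in as_ -> (n < k)%N -> hypergeom_term as_ bs z k = 0.
Proof.
move=> /(@big_rem _ _ _ _ _ _) hn ltnk.
rewrite /hypergeom_term hn /= {1}/pochhammer (bigD1 (Ordinal ltnk)) //=.
by rewrite addNr !mul0r.
Qed.

Definition f (C : numClosedFieldType) (n : nat) (x : C) : C :=
  pochhammer (3 / 2) n / n`!%:R * 'i ^+ n
    * hypergeom_upto n [:: - n%:R; 3 / 4 + 'i * x] [:: 3 / 2] 2.

Definition g (C : numClosedFieldType) (n : nat) (x : C) : C :=
  'i ^+ n * n.+1%:R
    * hypergeom_upto n [:: - n%:R; n%:R + 2; 3 / 4 + 'i * x] [:: 3 / 2; 3 / 2] 1.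

(* Main.v *)
Require Import Defs.
From mathcomp Require Import all_boot all_order all_algebra.
From mathcomp Require Import reals complex.
From mathcomp Require Import zify ring.

Set Implicit Arguments.
Unset Strict Implicit.
Unset Printing Implicit Defensive.

Import Order.TTheory GRing.Theory Num.Theory.
Local Open Scope ring_scope.

(** Let L be the linear functional on polynomials that sends the monomial of
    degree j to (3/4 + i x)_j / (3/2)_j.  Up to explicit constants, f_n(x) is L
    applied to y^n and g_n(x) is i^n times L applied to the Chebyshev polynomial
    of the second kind U_n(y), where y = 1 - 2X.  Indeed the terminating
    hypergeometric coefficients 2^j (-n)_j / j! and
    (n+1) (-n)_j (n+2)_j / ((3/2)_j j!) are (-2)^j C(n, j) and
    (-4)^j C(n+j+1, 2j+1), the coefficients of y^n and U_n(y)
    ([f_umbral], [g_umbral]).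

    The two relations are therefore the images under L of the two classical
    formulas that connect powers and Chebyshev polynomials: the explicit
    expansion of U_n(y) in powers of y ([chebS_expand]) and its inverse, in which
    ballot numbers appear ([expr_chebS]).  Both follow by induction from the
    recurrence of U_n and Pascal's rule.  The signs of the first expansion are
    absorbed by i^n = i^(n-2k) (-1)^k, which puts them in the second relation
    instead.

    The variable used below is z = 2y = 2 - 4X, which removes the powers of 2
    from the Chebyshev recurrence. *)

(** * Powers and Chebyshev polynomials *)

(** The value at n+1 is U_n(z/2).  Starting from U_(-1) = 0 at index 0 makes
    truncated indices harmless: in a sum over k of terms of index n + 1 - 2k, the
    terms past the middle vanish by themselves. *)
Fixpoint chebS (R : pzRingType) (z : R) (n : nat) : R :=
  if n is n1.+1 then
    if n1 is n2.+1 then z * chebS z n1 - chebS z n2 else 1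
  else 0.

Lemma chebSSS (R : pzRingType) (z : R) (n : nat) :
  chebS z n.+2 = z * chebS z n.+1 - chebS z n.
Proof. by []. Qed.

(** The summation bound N is free, because the binomial coefficient vanishes for
    2k > n.  In the induction, a bound common to three consecutive values of n lets
    the sums be added after a shift of the index by one. *)
Lemma chebS_expand (R : comNzRingType) (A : algType R) (z : A) (n N : nat) :
  (n./2 < N)%N ->
  chebS z n.+1 =
    \sum_(0 <= k < N) ((-1) ^+ k * 'C(n - k, k)%:R) *: z ^+ (n - 2 * k).
Proof.
elim/ltn_ind: n N => [[|[|n]]] IHn [|N] ltN //.
- rewrite big_nat_recl // big1 ?addr0 => [|k _]; last by rewrite bin0n mulr0 scale0r.
  by rewrite !mulr1 scale1r.
- rewrite big_nat_recl // big1 ?addr0 => [|k _]; last first.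
    by rewrite subSS sub0n bin0n mulr0 scale0r.
  by rewrite !mul1r scale1r /= mulr1 subr0.
have {}ltN : (n.+2 < 2 * N.+1)%N by lia.
rewrite chebSSS (IHn n.+1 _ N.+1) ?(IHn n _ N.+1); try lia.
rewrite big_nat_recl // [\sum_(0 <= i < N.+1) _ *: z ^+ (n - _)]big_nat_recr //=.
rewrite (bin_small (_ : n - N < N)%N) ?mulr0 ?scale0r ?addr0; last by lia.
rewrite [RHS]big_nat_recl // mulrDr -scalerAr -exprS -addrA.
rewrite !subn0 !bin0; congr (_ + _).
rewrite mulr_sumr -sumrB; apply: eq_bigr => k _.
rewrite -scalerAr.
have -> : (n.+2 - k.+1 = n.+1 - k)%N by lia.
have -> : (n.+2 - 2 * k.+1 = n - 2 * k)%N by lia.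
have -> : (n.+1 - k.+1 = n - k)%N by lia.
have -> : 'C(n.+1 - k, k.+1) = ('C(n - k, k.+1) + 'C(n - k, k))%N.
  have [le_kn|lt_nk] := leqP k n; first by rewrite subSn // binS.
  by rewrite !bin_small //; lia.
have [le_kn|lt_nk] := leqP (2 * k.+1) n.+1.
  rewrite -exprS.
  have -> : (n.+1 - 2 * k.+1).+1 = (n - 2 * k)%N by lia.
  by rewrite -scalerBl natrD exprS; congr (_ *: _); ring.
rewrite (bin_small (_ : n - k < k.+1)%N); last by lia.
by rewrite add0n mulr0 scale0r sub0r -scaleNr exprS mulN1r mulNr.
Qed.

(** The number of paths of n unit steps up or down that stay nonnegative and have
    k steps down, when 2k <= n; this reflects the rule z U_m = U_(m+1) + U_(m-1)
    with U_(-1) = 0.  For larger k the formula is the antisymmetric extension. *)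
Definition ballot (R : pzRingType) (n k : nat) : R :=
  'C(n, k)%:R - (if k is k1.+1 then 'C(n, k1) else 0%N)%:R.

Lemma ballot0 (R : pzRingType) (n : nat) : ballot R n 0 = 1.
Proof. by rewrite /ballot bin0 subr0. Qed.

Lemma ballotS (R : pzRingType) (n k : nat) :
  ballot R n.+1 k.+1 = ballot R n k.+1 + ballot R n k.
Proof.
rewrite /ballot binS natrD; case: k => [|k]; first by rewrite !bin0 subr0 addrAC.
by rewrite binS natrD opprD addrACA.
Qed.

(** The number that would multiply U_(-1): it lies on the axis of antisymmetry. *)
Lemma ballot_mid (R : pzRingType) (n k : nat) :
  (n.+1 = 2 * k)%N -> ballot R n k = 0.
Proof.
case: k => [|k] // defn; rewrite /ballot -(@bin_sub n k); last by lia.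
have -> : (n - k = k.+1)%N by lia.
by rewrite subrr.
Qed.

Lemma ballotE (R : comPzRingType) (n k : nat) :
  (2 * k <= n)%N ->
  n.+1%:R * ballot R n k = (n - 2 * k).+1%:R * 'C(n.+1, k)%:R.
Proof.
move=> le2kn; rewrite /ballot mulrBr -!natrM (mul_bin_down n.+1 k).
case: k le2kn => [|k] le2kn; first by rewrite muln0 subr0 !subn0.
rewrite (mul_bin_diag n.+1 k) -natrB.
  by rewrite -mulnBl; congr (_ * _)%:R; lia.
by rewrite leq_mul2r; apply/orP; right; lia.
Qed.

(** Multiplying term by term by z and using z U_m = U_(m+1) + U_(m-1) turns the
    coefficients of degree n into the sums of Pascal's rule for the ballot
    numbers. *)
Lemma expr_chebS (R : comNzRingType) (A : algType R) (z : A) (n N : nat) :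
  (n./2 < N)%N ->
  z ^+ n = \sum_(0 <= k < N) ballot R n k *: chebS z (n.+1 - 2 * k).
Proof.
elim: n N => [|n IHn] [//|N] ltN.
  rewrite big_nat_recl // big1 ?addr0 => [|k _].
    by rewrite ballot0 scale1r expr0.
  have -> : (1 - 2 * k.+1 = 0)%N by lia.
  by rewrite scaler0.
rewrite exprS (IHn N.+1); last by lia.
(* The recurrence fails only for the index m = 0 reached without truncation, at
   n + 1 = 2k, and there the ballot number is zero. *)
have step k : z * (ballot R n k *: chebS z (n.+1 - 2 * k))
    = ballot R n k *: chebS z (n.+2 - 2 * k) + ballot R n k *: chebS z (n - 2 * k).
  rewrite -scalerAr -scalerDr.
  have [le_kn|lt_nk] := leqP (2 * k) n.
    by rewrite !subSn ?chebSSS ?subrK //; lia.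
  have [eq_nk|ne_nk] := eqVneq n.+1 (2 * k)%N.
    by rewrite ballot_mid // !scale0r.
  have [-> -> ->] : [/\ n.+1 - 2 * k = 0, n.+2 - 2 * k = 0 & n - 2 * k = 0]%N.
    by split; lia.
  by rewrite /= mulr0 addr0.
rewrite mulr_sumr (eq_bigr _ (fun k _ => step k)) big_split /=.
rewrite big_nat_recl // [X in _ + X]big_nat_recr //= [RHS]big_nat_recl //.
have -> : (n - 2 * N = 0)%N by lia.
rewrite scaler0 addr0 -addrA !ballot0; congr (_ + _).
rewrite -big_split /=; apply: eq_bigr => k _.
have -> : (n.+2 - 2 * k.+1 = n - 2 * k)%N by lia.
by rewrite -scalerDl ballotS.
Qed.

(** * The functional and the hypergeometric coefficients *)

Definition zpoly (R : nzRingType) : {poly R} := 2%:P - 4 *: 'X.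

Lemma coef_zpoly_exp (R : comNzRingType) (n j : nat) :
  (zpoly R ^+ n)`_j = 2 ^+ n * (- 2) ^+ j * 'C(n, j)%:R.
Proof.
elim: n j => [|n IHn] j.
  by rewrite expr0 coef1 bin0n; case: j => [|j]; rewrite ?mulr0 ?mulr1.
rewrite exprS mulrBl coefB coefCM -scalerAl coefZ coefXM.
case: j => [|j] /=; rewrite !IHn ?bin0; first by rewrite exprS; ring.
by rewrite binS natrD !exprS; ring.
Qed.

(** Both sides satisfy the recurrence w_(n+2, j) = 2 w_(n+1, j) - 4 w_(n+1, j-1)
    - w_(n, j); for the binomial coefficients it is Pascal's rule. *)
Lemma coef_chebS_zpoly (R : comNzRingType) (n j : nat) :
  (chebS (zpoly R) n)`_j = (- 4) ^+ j * 'C(n + j, (2 * j).+1)%:R.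
Proof.
elim/ltn_ind: n j => [[|[|n]]] IHn j.
- by rewrite coef0 bin_small ?mulr0 //; lia.
- rewrite coef1; case: j => [|j]; first by rewrite mulr1.
  by rewrite bin_small ?mulr0 //; lia.
rewrite chebSSS coefB mulrBl coefB coefCM -scalerAl coefZ coefXM !IHn //.
case: j => [|j] /=; first by rewrite muln0 !addn0 !bin1 -[n.+2%:R]natr1 -[n.+1%:R]natr1; ring.
have -> : (2 * j.+1 = (2 * j).+2)%N by lia.
rewrite !addnS !addSn !binS !natrD !exprS; ring.
Qed.

(** The linear functional with moments u, cut at degree N: linearity is then
    immediate, and the cut has no effect on polynomials of degree below N. *)
Definition umbral (R : nzRingType) (N : nat) (u : nat -> R) (p : {poly R}) : R :=
  \sum_(0 <= j < N) p`_j * u j.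

Lemma umbral_sum (R : nzRingType) (N M : nat) (u : nat -> R)
    (a : nat -> R) (p : nat -> {poly R}) :
  umbral N u (\sum_(0 <= k < M) a k *: p k)
  = \sum_(0 <= k < M) a k * umbral N u (p k).
Proof.
under [RHS]eq_bigr do rewrite /umbral mulr_sumr.
rewrite exchange_big; apply: eq_bigr => j _ /=.
by rewrite coef_sum mulr_suml; apply: eq_bigr => k _; rewrite coefZ mulrA.
Qed.

Lemma pochhammerS (F : fieldType) (a : F) (n : nat) :
  pochhammer a n.+1 = pochhammer a n * (a + n%:R).
Proof. by rewrite /pochhammer big_ord_recr. Qed.

Lemma pochhammer_32_neq0 (F : numFieldType) (n : nat) :
  pochhammer (3 / 2 : F) n != 0.
Proof.
apply: lt0r_neq0; apply: prodr_gt0 => j _.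
by rewrite ltr_wpDr ?ler0n // divr_gt0 ?ltr0n.
Qed.

Lemma pochhammer_opp (F : fieldType) (n j : nat) :
  pochhammer (- n%:R : F) j = (-1) ^+ j * (n ^_ j)%:R.
Proof.
elim: j => [|j IHj]; first by rewrite /pochhammer big_ord0 mulr1.
rewrite pochhammerS IHj ffactnSr natrM exprS.
have [le_jn|lt_nj] := leqP j n; first by rewrite natrB //; ring.
by rewrite ffact_small // !(mul0r, mulr0).
Qed.

(** The product (3/2)_j j! interleaves the odd and even factors of (2j+1)!. *)
Lemma pochhammer_32_fact (F : numFieldType) (j : nat) :
  4 ^+ j * (pochhammer (3 / 2 : F) j * j`!%:R) = (2 * j).+1`!%:R.
Proof.
elim: j => [|j IHj]; first by rewrite /pochhammer big_ord0 !mulr1.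
have -> : ((2 * j.+1).+1 = (2 * j).+3)%N by lia.
rewrite 3!factS 3!natrM -IHj pochhammerS exprS -!natr1 natrM.
by field.
Qed.

(** The two Pochhammer symbols in the numerator of g_n, together with n + 1, fill
    the consecutive integers from n - j + 1 to n + j + 1. *)
Lemma pochhammer_ffact (F : fieldType) (n j : nat) :
  n.+1%:R * (pochhammer (n%:R + 2 : F) j * (n ^_ j)%:R)
  = ((n + j).+1 ^_ (2 * j).+1)%:R.
Proof.
elim: j => [|j IHj].
  by rewrite /pochhammer big_ord0 muln0 addn0 ffactn1 ffactn0 !mulr1.
have -> : ((2 * j.+1).+1 = (2 * j).+3)%N by lia.
rewrite addnS ffactSS 2!ffactnSr 3!natrM -IHj pochhammerS.
have -> : ((n + j).+1 - (2 * j).+1 = n - j)%N by lia.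
by rewrite -!natr1 natrD; ring.
Qed.

Definition moment (C : numClosedFieldType) (x : C) (j : nat) : C :=
  pochhammer (3 / 4 + 'i * x) j / pochhammer (3 / 2) j.

(** The powers of 2 in the denominator compensate for the use of z^n = 2^n y^n. *)
Lemma f_umbral (C : numClosedFieldType) (N n : nat) (x : C) :
  (n < N)%N ->
  f n x = pochhammer (3 / 2) n / (2 ^+ n * n`!%:R) * 'i ^+ n
            * umbral N (moment x) (zpoly C ^+ n).
Proof.
move=> ltnN; rewrite /f /hypergeom_upto /umbral.
rewrite [in RHS](@big_cat_nat _ _ _ n.+1) // [X in _ * (_ + X)]big1_seq ?addr0; last first.
  move=> j /andP[_]; rewrite mem_index_iota => /andP[ltnj _].
  by rewrite coef_zpoly_exp bin_small // mulr0 mul0r.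
rewrite !mulr_sumr; apply: eq_bigr => j _.
rewrite /hypergeom_term !big_cons !big_nil !mulr1 pochhammer_opp coef_zpoly_exp.
rewrite -bin_ffact natrM /moment (exprNn 2).
have fn0 m : m`!%:R != 0 :> C by rewrite pnatr_eq0 -lt0n fact_gt0.
by field; rewrite ?fn0 ?pochhammer_32_neq0 ?expf_neq0 ?pnatr_eq0.
Qed.

Lemma g_umbral (C : numClosedFieldType) (N n : nat) (x : C) :
  (n < N)%N ->
  g n x = 'i ^+ n * umbral N (moment x) (chebS (zpoly C) n.+1).
Proof.
move=> ltnN; rewrite /g /hypergeom_upto /umbral.
rewrite [in RHS](@big_cat_nat _ _ _ n.+1) // [X in _ * (_ + X)]big1_seq ?addr0; last first.
  move=> j /andP[_]; rewrite mem_index_iota => /andP[ltnj _].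
  by rewrite coef_chebS_zpoly bin_small ?mulr0 ?mul0r //; lia.
rewrite -mulrA; congr (_ * _); rewrite mulr_sumr; apply: eq_bigr => j _.
rewrite /hypergeom_term !big_cons !big_nil !mulr1 expr1n coef_chebS_zpoly.
have fn0 m : m`!%:R != 0 :> C by rewrite pnatr_eq0 -lt0n fact_gt0.
have binE : 'C(n.+1 + j, (2 * j).+1)%:R * (4 ^+ j * (pochhammer (3 / 2 : C) j * j`!%:R))
  = n.+1%:R * (pochhammer (n%:R + 2 : C) j * (n ^_ j)%:R).
  by rewrite pochhammer_32_fact pochhammer_ffact -natrM bin_ffact addSn.
have n4 : (4 ^+ j : C) != 0 by rewrite expf_neq0 ?pnatr_eq0.
have -> : 'C(n.+1 + j, (2 * j).+1)%:R = n.+1%:R * (pochhammer (n%:R + 2 : C) j * (n ^_ j)%:R)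
   / (4 ^+ j * (pochhammer (3 / 2 : C) j * j`!%:R)).
  by rewrite -binE mulfK // !mulf_neq0 ?pochhammer_32_neq0.
rewrite pochhammer_opp /moment (exprNn 4).
by field; rewrite ?fn0 ?pochhammer_32_neq0 ?n4.
Qed.

Lemma expCi_sub2 (C : numClosedFieldType) (n k : nat) :
  (2 * k <= n)%N -> 'i ^+ n = 'i ^+ (n - 2 * k) * (-1) ^+ k :> C.
Proof. by move=> le2kn; rewrite -sqrCi -exprM -exprD subnK. Qed.

(** * The connection formulas *)

Theorem propositionA1 (R : realType) (n : nat) (x : R[i]) :
  g n x = \sum_(0 <= k < n./2.+1)
            2 ^+ (n - 2 * k) * (n - k)`!%:R
              / (pochhammer (3 / 2) (n - 2 * k) * k`!%:R) * f (n - 2 * k) x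
  /\
  f n x = pochhammer (3 / 2) n / (2 ^+ n * (n.+1)`!%:R)
            * \sum_(0 <= k < n./2.+1)
                (-1) ^+ k * (n - 2 * k).+1%:R * 'C(n.+1, k)%:R * g (n - 2 * k) x.
Proof.
have fn0 m : m`!%:R != 0 :> R[i] by rewrite pnatr_eq0 -lt0n fact_gt0.
have n2 m : (2 ^+ m : R[i]) != 0 by rewrite expf_neq0 ?pnatr_eq0.
have sgn k : (-1) ^+ k * (-1) ^+ k = 1 :> R[i] by rewrite -expr2 sqrr_sign.
split.
  rewrite (g_umbral _ (ltnSn n)) (chebS_expand _ (ltnSn n./2)) umbral_sum mulr_sumr.
  apply: eq_big_nat => k /andP[_ ltk].
  rewrite (@f_umbral _ n.+1); last by lia.
  have le2kn : (2 * k <= n)%N by lia.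
  rewrite (expCi_sub2 _ le2kn) -(@bin_fact (n - k) k); last by lia.
  have -> : (n - k - k = n - 2 * k)%N by lia.
  (* The sign of the Chebyshev expansion cancels the one from i^n. *)
  rewrite !natrM [LHS](_ : _ = ((-1) ^+ k * (-1) ^+ k) * ('i ^+ (n - 2 * k)
     * 'C(n - k, k)%:R * umbral n.+1 (moment x) (zpoly _ ^+ (n - 2 * k)))); last by ring.
  rewrite sgn; field.
  by rewrite ?fn0 ?pochhammer_32_neq0 ?n2.
rewrite (f_umbral _ (ltnSn n)) (expr_chebS _ (ltnSn n./2)) umbral_sum !mulr_sumr.
apply: eq_big_nat => k /andP[_ ltk].
have le2kn : (2 * k <= n)%N by lia.
rewrite (@g_umbral _ n.+1); last by lia.
rewrite (expCi_sub2 _ le2kn) subSn // factS natrM.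
(* Written with the ballot number, both sides differ only by the factor n + 1 of
   (n + 1)!. *)
have -> : (-1) ^+ k * (n - 2 * k).+1%:R * 'C(n.+1, k)%:R
    = (-1) ^+ k * (n.+1%:R * ballot _ n k) :> R[i] by rewrite ballotE // mulrA.
field.
by rewrite ?fn0 ?n2 nat1r ?pnatr_eq0.
Qed.
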